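(* Let $p>q$ be positive integers with $\gcd(p,q)=1$. The word corresponding to $\frac{q}{p}$ realizes the Euclidean algorithm. Furthermore, the number $N_\sigma(n)$ of $\sigma$'s within a word of length $n$ corresponds to the number of steps performed in the Euclidean algorithm.
   Context: The maps $\sigma$ and $\tau$ act on fractions $\frac{q}{p}$ with $p,q$ positive integers, $\gcd(p,q)=1$, by $\sigma\left(\frac{q}{p}\right)=\frac{p}{q}$ and $\tau\left(\frac{q}{p}\right)=\frac{q}{p+q}$. Products denote composition, with the rightmost map applied first. A word is a product $\sigma^j\tau^{n_1}\sigma\tau^{n_2}\cdots\sigma\tau^{n_k}$ with integers $n_i\ge 1$ and $j\in\{0,1\}$; its length $n$ is the total number of $\tau$'s and $\sigma$'s in it. The word corresponding to $\frac{q}{p}$ is the unique word which, applied to $\frac11$, gives $\frac{q}{p}$; it has $j=0$ if $q<p$ and $j=1$ if $q>p$. ''Realizes the Euclidean algorithm'' is meant in the following sense: a division with remainder $p=n_1 q+r_1$ in the Euclidean algorithm corresponds to the identity $\frac{q}{p}=\tau^{n_1}\sigma\left(\frac{r_1}{q}\right)$, the next division $q=n_2r_1+r_2$ corresponds to $\frac{r_1}{q}=\tau^{n_2}\sigma\left(\frac{r_2}{r_1}\right)$, and so on, until one ends up with $\frac{q}{p}=\tau^{n_1}\sigma\tau^{n_2}\cdots\sigma\tau^{n_k}\left(\frac11\right)$, in which the number of $\sigma$'s is $N_\sigma=k-1$. *)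

(* Defs.v *)
From mathcomp Require Import all_boot all_order all_algebra.
Set Implicit Arguments.
Unset Strict Implicit.
Unset Printing Implicit Defensive.

Definition nat_frac (q p : nat) : rat := (q%:Q / p%:Q)%R.

(* [numq] and [denq] are the terms of the reduced fraction, so for coprime
   positive q and p these are sigma(q/p) = p/q and tau(q/p) = q/(p+q); the
   values at rationals <= 0 are never used. *)
Definition sigma (x : rat) : rat := ((denq x)%:Q / (numq x)%:Q)%R.
Definition tau (x : rat) : rat := ((numq x)%:Q / (denq x + numq x)%:Q)%R.

Inductive letter := Sigma | Tau.

Definition act (l : letter) : rat -> rat :=
  match l with Sigma => sigma | Tau => tau end.

(* The head of the list is the leftmost factor, hence it is applied last. *)
Definition eval_word (w : seq letter) (x : rat) : rat := foldr act x w.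

(* tau^n_1 sigma tau^n_2 ... sigma tau^n_k *)
Fixpoint tau_blocks (ns : seq nat) : seq letter :=
  match ns with
  | [::] => [::]
  | [:: n] => nseq n Tau
  | n :: ns' => nseq n Tau ++ Sigma :: tau_blocks ns'
  end.

(* The boolean j is coerced to the exponent 0 or 1 of the leading sigma. *)
Definition spell (j : bool) (ns : seq nat) : seq letter :=
  nseq j Sigma ++ tau_blocks ns.

Definition is_word (w : seq letter) : Prop :=
  exists (j : bool) (ns : seq nat),
    [/\ 0 < size ns, all (leq 1) ns & w = spell j ns].

Definition corresponds (w : seq letter) (q p : nat) : Prop :=
  is_word w /\ eval_word w (nat_frac 1 1) = nat_frac q p.

Definition is_sigma (l : letter) : bool := if l is Sigma then true else false.

Definition N_sigma (n : nat) (w : n.-tuple letter) : nat := count is_sigma w.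

(* dividend = quotient * divisor + remainder *)
Record division := Division
  { dividend : nat; divisor : nat; quotient : nat; remainder : nat }.

Fixpoint euclid_rec (fuel a b : nat) : seq division :=
  if fuel is fuel'.+1 then
    if b == 0 then [::]
    else Division a b (a %/ b) (a %% b) :: euclid_rec fuel' b (a %% b)
  else [::].

(* All the divisions of the Euclidean algorithm on (a, b), up to and including
   the one with remainder 0. As the divisors strictly decrease, at most b
   divisions are performed and the fuel b never runs out early. *)
Definition euclid (a b : nat) : seq division := euclid_rec b a b.

(* A division a = n * b + r with r > 0 corresponds to b/a = tau^n sigma (r/b).
   The final division a = (n + 1) * 1 + 0 has divisor 1 and corresponds to
   1/a = tau^n (1/1): its quotient exceeds the exponent n by one. *)
Fixpoint realizes_divisions (ds : seq division) (ns : seq nat) : Prop :=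
  match ds, ns with
  | [:: d], [:: n] =>
      [/\ divisor d = 1, remainder d = 0, quotient d = n.+1
        & nat_frac (divisor d) (dividend d) = eval_word (nseq n Tau) (nat_frac 1 1)]
  | d :: ds', n :: ns' =>
      [/\ 0 < remainder d, quotient d = n,
          nat_frac (divisor d) (dividend d) =
            eval_word (rcons (nseq n Tau) Sigma) (nat_frac (remainder d) (divisor d))
        & realizes_divisions ds' ns']
  | _, _ => False
  end.

Definition realizes_euclid (w : seq letter) (p q : nat) : Prop :=
  exists ns : seq nat,
    [/\ w = spell false ns, realizes_divisions (euclid p q) ns
      & nat_frac q p = eval_word w (nat_frac 1 1)].

(* The steps matched by a sigma are those leaving a nonzero remainder. *)
Definition euclid_steps (p q : nat) : nat :=
  count (fun d => 0 < remainder d) (euclid p q).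

(* Main.v *)
(* As rational maps, sigma x = 1/x and tau x = x/(1+x).  For x > 0 we have
   tau x < 1, so the value of a word at 1 is < 1, > 1 or = 1 according to
   whether the word starts with tau, starts with sigma or is empty; as sigma
   and tau are injective on positive rationals, the value determines the word
   letter by letter.  Existence follows from running the Euclidean algorithm:
   p = n q + r gives q/p = tau^n sigma (r/q), and the last division
   p = p * 1 + 0 gives 1/p = tau^(p-1) (1/1). *)
Require Import Defs.
From mathcomp Require Import all_boot all_order all_algebra.
From mathcomp Require Import lra zify.
Set Implicit Arguments.
Unset Strict Implicit.
Unset Printing Implicit Defensive.
Import Order.TTheory GRing.Theory Num.Theory.

Lemma sigmaE (x : rat) : sigma x = (x^-1)%R.
Proof. by rewrite /sigma -[in RHS](divq_num_den x) invf_div. Qed.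

Lemma tauE (x : rat) : tau x = (x / (1 + x))%R.
Proof.
have den0 : ((denq x)%:Q != 0)%R by rewrite intr_eq0 denq_neq0.
rewrite /tau rmorphD /=.
move: (numq x) (denq x) den0 (divq_num_den x) => a b b0 <-.
by rewrite -[X in (X + _ / _)%R](divff b0) -mulrDl invf_div mulrA divfK.
Qed.

Lemma tau_gt0 (x : rat) : (0 < x -> 0 < tau x)%R.
Proof. by move=> x0; rewrite tauE divr_gt0 // addr_gt0. Qed.

Lemma tau_lt1 (x : rat) : (0 < x -> tau x < 1)%R.
Proof. by move=> x0; rewrite tauE ltr_pdivrMr; lra. Qed.

Lemma tau_inj (x y : rat) : (0 < x -> 0 < y -> tau x = tau y -> x = y)%R.
Proof.
rewrite !tauE => x0 y0 /eqP; rewrite eqr_div; [move/eqP; lra | lra | lra].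
Qed.

(** Injectivity holds on all of [rat], because inversion with the convention [0^-1 = 0] is an
    involution. *)
Lemma sigma_inj : injective sigma.
Proof. by move=> x y; rewrite !sigmaE => /invr_inj. Qed.

Lemma eval_word_gt0 (w : seq letter) : (0 < eval_word w 1)%R.
Proof.
by elim: w => [|[] w IH] //=; [rewrite sigmaE invr_gt0 | exact: tau_gt0].
Qed.

(* The words sigma^j tau^n_1 sigma ... tau^n_k, together with the empty one. *)
Fixpoint reduced (w : seq letter) : bool :=
  match w with
  | [::] => true
  | Tau :: w' => reduced w'
  | Sigma :: w' => if w' is Tau :: _ then reduced w' else false
  end.

Lemma reduced_inj (v w : seq letter) : reduced v -> reduced w ->
  eval_word v 1 = eval_word w 1 -> v = w.
Proof.
have lt1 u : (eval_word (Tau :: u) 1 < 1)%R by exact/tau_lt1/eval_word_gt0.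
(* Reducedness makes the tail start with [Tau], so its value lies in (0, 1); the lone letter
   [Sigma], with value 1, is excluded. *)
have gt1 u : reduced (Sigma :: u) -> (1 < eval_word (Sigma :: u) 1)%R.
  case: u => [|[] u] //= _.
  by rewrite sigmaE invf_gt1 ?lt1 //; exact: (eval_word_gt0 (Tau :: u)).
have sub l u : reduced (l :: u) -> reduced u by case: l => //; case: u => [|[]].
elim: v w => [|a v IH] [|b w] // rv rw.
- by case: b rw => [/gt1|_]; [|have := lt1 w] => /[swap] <-; rewrite ltxx.
- by case: a rv => [/gt1|_]; [|have := lt1 v] => /[swap] ->; rewrite ltxx.
case: a b rv rw => [] [] rv rw eq_vw.
- by rewrite (IH w (sub _ _ rv) (sub _ _ rw) (sigma_inj eq_vw)).
- by have := gt1 _ rv; rewrite eq_vw => /(lt_trans (lt1 w)); rewrite ltxx.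
- by have := gt1 _ rw; rewrite -eq_vw => /(lt_trans (lt1 v)); rewrite ltxx.
- rewrite (IH w) //; exact: tau_inj (eval_word_gt0 v) (eval_word_gt0 w) eq_vw.
Qed.

Lemma tau_blocks_cons (n : nat) (ns : seq nat) : 0 < size ns ->
  tau_blocks (n :: ns) = nseq n Tau ++ Sigma :: tau_blocks ns.
Proof. by case: ns. Qed.

Lemma reduced_tau (n : nat) (w : seq letter) :
  reduced (nseq n Tau ++ w) = reduced w.
Proof. by elim: n. Qed.

Lemma reduced_spell (j : bool) (ns : seq nat) :
  0 < size ns -> all (leq 1) ns -> reduced (spell j ns).
Proof.
elim: ns j => // n ns IH j _ /= /andP[n0 ns1].
have [ns0|ns0] := posnP (size ns).
  by move/size0nil: ns0 => ->; case: j n n0 => [] [|n] //= _; elim: n.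
rewrite /spell tau_blocks_cons //.
(* The case [j = true] covers the separating sigma together with the remaining blocks. *)
have := IH true ns0 ns1; rewrite /spell /= => r.
by case: j n n0 => [] [|n] //= _; rewrite reduced_tau.
Qed.

Lemma reduced_is_word (w : seq letter) : is_word w -> reduced w.
Proof. by case=> j [ns [ns0 ns1 ->]]; exact: reduced_spell. Qed.

Lemma nat_frac11 : nat_frac 1 1 = 1%R.
Proof. by []. Qed.

Lemma eval_word_cat (v w : seq letter) (x : rat) :
  eval_word (v ++ w) x = eval_word v (eval_word w x).
Proof. by rewrite /eval_word foldr_cat. Qed.

Lemma sigma_nat_frac (q p : nat) : sigma (nat_frac q p) = nat_frac p q.
Proof. by rewrite sigmaE /nat_frac invf_div. Qed.

(** In the form x / (1 + x), each tau adds the numerator to the denominator of any representative of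
    the fraction, reduced or not. *)
Lemma eval_tau (n q p : nat) : 0 < p ->
  eval_word (nseq n Tau) (nat_frac q p) = nat_frac q (n * q + p).
Proof.
move=> p0; elim: n => //= n ->; rewrite mulSn -addnA tauE /nat_frac.
have [x0 y0] : ((n * q + p)%:R != 0 :> rat)%R /\ ((q + (n * q + p))%:R != 0 :> rat)%R.
  by rewrite !pnatr_eq0; lia.
rewrite -!pmulrn [in RHS]natrD -[X in (X + _ / _)%R](divff x0) -mulrDl invf_div.
by rewrite mulrA divfK // addrC.
Qed.

Lemma eval_tau_sigma (n r q : nat) : 0 < r ->
  eval_word (rcons (nseq n Tau) Sigma) (nat_frac r q) = nat_frac q (n * q + r).
Proof.
by move=> r0; rewrite -cats1 eval_word_cat /= sigma_nat_frac eval_tau.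
Qed.

(** Induction on the fuel, which is only bounded below by [q]: the recursive call keeps [fuel - 1],
    possibly more than the new divisor [p %% q]. *)
Lemma euclid_word (fuel q p : nat) :
  0 < q -> q < p -> coprime p q -> q <= fuel ->
  exists ns : seq nat,
    [/\ 0 < size ns, all (leq 1) ns,
        realizes_divisions (euclid_rec fuel p q) ns,
        eval_word (tau_blocks ns) 1 = nat_frac q p
      & size (euclid_rec fuel p q) = size ns
        /\ count (fun d => 0 < remainder d) (euclid_rec fuel p q)
           = (size ns).-1].
Proof.
elim: fuel q p => [|fuel IH] q p q0 lt_qp cop le_qf; first by lia.
have [q1|q_neq1] := eqVneq q 1.
  have p0 : 0 < p by lia.
  have frac1p : eval_word (nseq p.-1 Tau) (nat_frac 1 1) = nat_frac 1 p.
    by rewrite eval_tau // muln1 addn1 prednK.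
  rewrite q1 /= modn1 divn1.
  have -> : euclid_rec fuel 1 0 = [::] by case: fuel {IH le_qf}.
  (* The last quotient is [p], but only [p - 1] taus lead from 1/1 to 1/p; this exponent is positive
     since [1 < p]. *)
  exists [:: p.-1]; split=> //=; first by lia.
  by split=> //=; lia.
(* A zero remainder would make [q] the gcd, hence [q = 1]. *)
have r0 : 0 < p %% q.
  rewrite lt0n; apply: contra q_neq1 => /eqP r0.
  by move: cop; rewrite -coprime_modl r0 /coprime gcd0n.
have lt_rq : p %% q < q by rewrite ltn_mod.
have co_qr : coprime q (p %% q) by rewrite coprime_modr coprime_sym.
have [|ns [ns0 ns1 real_ns eval_ns [size_ns count_ns]]] :=
  IH _ _ r0 lt_rq co_qr; first by lia.
have eq_frac : eval_word (rcons (nseq (p %/ q) Tau) Sigma) (nat_frac (p %% q) q)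
    = nat_frac q p by rewrite eval_tau_sigma // -divn_eq.
exists (p %/ q :: ns); rewrite /= (gtn_eqF q0) /=; split=> //.
- by rewrite divn_gt0 // (ltnW lt_qp).
(* Both tails are nonempty, which selects the branch of [realizes_divisions] for a nonzero
   remainder. *)
- by case: (euclid_rec _ _ _) real_ns => [|d ds]; case: (ns) ns0.
- by rewrite -[LHS]/(eval_word (tau_blocks (_ :: _)) 1) tau_blocks_cons //
    -cat_rcons eval_word_cat eval_ns.
- by rewrite size_ns count_ns r0 add1n prednK.
Qed.

(** Each block except the first is preceded by exactly one sigma. *)
Lemma count_sigma_tau_blocks (ns : seq nat) :
  count is_sigma (tau_blocks ns) = (size ns).-1.
Proof.
elim: ns => // n ns IH; have [ns0|ns0] := posnP (size ns).
  by move/size0nil: ns0 => -> /=; rewrite count_nseq mul0n.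
by rewrite tau_blocks_cons // count_cat /= count_nseq IH mul0n add1n prednK.
Qed.

Theorem theorem2p3 (p q : nat) (q_gt0 : 0 < q) (lt_qp : q < p)
    (co_pq : gcdn p q = 1) :
  (exists! w : seq letter, corresponds w q p) /\
  (forall (n : nat) (w : n.-tuple letter), corresponds w q p ->
     [/\ realizes_euclid w p q,
         N_sigma w = euclid_steps p q
       & size (euclid p q) = (N_sigma w).+1]).
Proof.
have cop : coprime p q by apply/eqP.
have [ns [ns0 ns1 real_ns eval_ns [size_ns count_ns]]] :=
  euclid_word q_gt0 lt_qp cop (leqnn q).
have word_ns : corresponds (spell false ns) q p.
  by split; [exists false, ns | rewrite nat_frac11].
have uniq_w w : corresponds w q p -> spell false ns = w.
  case=> word_w eval_w; apply: reduced_inj.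
  - exact: reduced_spell.
  - exact: reduced_is_word.
  - by rewrite -nat_frac11 eval_w eval_ns.
split; first by exists (spell false ns).
move=> n w /uniq_w eq_w.
have N_w : N_sigma w = (size ns).-1 by rewrite /N_sigma -eq_w count_sigma_tau_blocks.
split; last by rewrite N_w prednK.
- by exists ns; split; rewrite // -eq_w nat_frac11 eval_ns.
- by rewrite N_w -count_ns.
Qed.
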